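(* Let $\bar d=(d_j)_{j\ge 0}$ be integers with $d_0=1$ and $d_j\ge 2$ for $j\ge 1$, and let $\bar p=(p_j)_{j\ge 1}$ with $p_j\in(0,1]$. If $\lim_{j\to\infty}p_j=1$, then the interior of $\sigma_p(c_0,\bar d,\bar p)$ is not empty. Precisely, there exist a real number $r>0$ and an integer $j_0\ge1$ such that for all integers $j\ge j_0$ the open set $g_j^{-1}(B(0,r))$ is contained in $\sigma_p(c_0,\bar d,\bar p)$.
   Context: $\mathbb{Z}_+=\{0,1,2,\dots\}$. Put $q_j=d_0d_1\cdots d_j$ for $j\ge 0$. Every $n\in\mathbb{Z}_+$ has a unique expansion $n=\sum_{j\ge1}a_j(n)q_{j-1}$ with digits $a_j(n)\in\{0,\dots,d_j-1\}$, only finitely many nonzero. Put $\zeta_n=\min\{j\ge1: a_j(n)\ne d_j-1\}$. Let $S=[s(n,m)]_{n,m\ge0}$ be the stochastic matrix with entries: $s(n,n+1)=\prod_{j=1}^{\zeta_n}p_j$; $s(n,n)=1-p_1$; if $\zeta_n\ge2$, for $1\le r\le\zeta_n-1$, $s\big(n,\,n-\sum_{j=1}^r(d_j-1)q_{j-1}\big)=(1-p_{r+1})\prod_{j=1}^rp_j$; and $s(n,m)=0$ otherwise. $(Sw)(n)=\sum_m s(n,m)w(m)$ defines a bounded linear operator on $c_0$ (complex sequences indexed by $\mathbb{Z}_+$ tending to $0$, sup norm). $\sigma_p(c_0,\bar d,\bar p)$ denotes the point spectrum (set of eigenvalues) of $S$ acting on $c_0$. For $j\ge1$ let $h_j(z)=\frac{z-(1-p_j)}{p_j}$,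 $f_j(z)=h_j(z)^{d_j}$, $z\in\mathbb{C}$; $\tilde f_0=\mathrm{id}$ and $\tilde f_j=f_j\circ\cdots\circ f_1$ for $j\ge1$. For $n\ge1$, $g_n:\mathbb{C}\to\mathbb{C}$ is $g_n=h_n\circ\tilde f_{n-1}$. $B(0,r)$ is the open disc of radius $r$ centred at $0$ in $\mathbb{C}$. *)

(* Defs.v *)
From HB Require Import structures.
From mathcomp Require Import all_boot all_order all_algebra.
From mathcomp Require Import complex.
From mathcomp Require Import all_classical all_reals all_analysis.

Set Implicit Arguments.
Unset Strict Implicit.
Unset Printing Implicit Defensive.

Import Order.TTheory GRing.Theory Num.Theory numFieldNormedType.Exports.

Local Open Scope classical_set_scope.
Local Open Scope ring_scope.
Local Open Scope complex_scope.

(* The usual topology of the complex plane, induced by the modulus. *)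
HB.instance Definition _ (R : rcfType) := NormedModule.copy R[i] R[i]^o.

Section Numeration.
Variable d : nat -> nat.

Definition q (j : nat) : nat := \prod_(i < j.+1) d i.

(* a_j(n), for 1 <= j; digit_expansion and digit_unique below identify it with
   the j-th digit of the expansion of n in the mixed-radix system d. *)
Definition digit (j n : nat) : nat := (n %/ q j.-1) %% d j.

(* The minimum, characterized as the member of the set that bounds it from
   below; 0 is a default value, never taken when 2 <= d j for all j >= 1
   (zetaP). *)
Definition zeta (n : nat) : nat :=
  let non_maximal := [set j | (1 <= j)%N /\ digit j n <> (d j - 1)%N] in
  xget 0%N [set j | non_maximal j /\ forall i, non_maximal i -> (j <= i)%N].

End Numeration.

(* p 0 is never used. *)
Section Adding_machine.
Variables (R : realType) (d : nat -> nat) (p : nat -> R).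

(* The target n - \sum_(1 <= j <= r) (d_j - 1) q_(j-1) is compared with m after
   moving the sum to the other side, which avoids truncated subtraction. The
   targets of distinct r are distinct, so the last sum has at most one term;
   it is empty when zeta_n = 1. *)
Definition s (n m : nat) : R :=
  if m == n.+1 then \prod_(1 <= j < (zeta d n).+1) p j
  else if m == n then 1 - p 1%N
  else \sum_(1 <= r < zeta d n |
             n == (m + \sum_(1 <= j < r.+1) (d j - 1) * q d j.-1)%N)
         (1 - p r.+1) * \prod_(1 <= j < r.+1) p j.

Definition opS (w : nat -> R[i]) (n : nat) : R[i] :=
  limn (series (fun m => (s n m)%:C * w m)).

Definition c0 : set (nat -> R[i]) := [set w | w @ \oo --> (0 : R[i])].

Definition sigma_p : set R[i] :=
  [set l | exists w, [/\ c0 w, w <> cst 0 & forall n, opS w n = l * w n]].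

Definition h (j : nat) (z : R[i]) : R[i] := (z - (1 - p j)%:C) / (p j)%:C.

Definition f (j : nat) (z : R[i]) : R[i] := h j z ^+ d j.

Fixpoint ftilde (j : nat) (z : R[i]) : R[i] :=
  if j is k.+1 then f k.+1 (ftilde k z) else z.

Definition g (n : nat) (z : R[i]) : R[i] := h n (ftilde n.-1 z).

End Adding_machine.

Section Facts.
Local Open Scope nat_scope.
Variable d : nat -> nat.
Hypotheses (d0 : d 0 = 1) (d_ge2 : forall j, 1 <= j -> 2 <= d j).

Lemma q0 : q d 0 = 1.
Proof. by rewrite /q big_ord_recr big_ord0 /= d0. Qed.

Lemma qS j : q d j.+1 = q d j * d j.+1.
Proof. by rewrite /q big_ord_recr. Qed.

Lemma q_gt0 j : 0 < q d j.
Proof.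
elim: j => [|j IH]; first by rewrite q0.
by rewrite qS muln_gt0 IH /= (leq_trans _ (d_ge2 (ltn0Sn j))).
Qed.

Lemma ltn_q n : n < q d n.
Proof.
elim: n => [|n IH]; first by rewrite q0.
rewrite qS (leq_trans _ (leq_mul IH (d_ge2 (ltn0Sn n)))) //.
by rewrite muln2 -addnn addSn ltnS addnS ltnS leq_addl.
Qed.

Lemma digit_lt j n : 1 <= j -> digit d j n < d j.
Proof. by move=> j1; rewrite ltn_pmod // (leq_trans _ (d_ge2 j1)). Qed.

Lemma digit_eq0 j n : n < q d j.-1 -> digit d j n = 0.
Proof. by move=> nq; rewrite /digit divn_small // mod0n. Qed.

Lemma sum_digit N n :
  n = \sum_(1 <= j < N.+1) digit d j n * q d j.-1 + n %/ q d N * q d N.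
Proof.
elim: N => [|N IH]; first by rewrite big_geq // q0 divn1 muln1.
rewrite big_nat_recr //= {1}IH -addnA; congr addn.
rewrite {1}(divn_eq (n %/ q d N) (d N.+1)) mulnDl addnC; congr addn.
by rewrite -divnMA qS -mulnA (mulnC (d _)).
Qed.

Lemma digit_expansion N n : n < q d N ->
  n = \sum_(1 <= j < N.+1) digit d j n * q d j.-1.
Proof. by move=> nN; rewrite {1}(sum_digit N n) divn_small // mul0n addn0. Qed.

Lemma sum_lt_q (a : nat -> nat) N : (forall j, 1 <= j -> a j < d j) ->
  \sum_(1 <= j < N.+1) a j * q d j.-1 < q d N.
Proof.
move=> ad; elim: N => [|N IH]; first by rewrite big_geq // q0.
rewrite big_nat_recr //= qS -addSn (leq_trans (leq_add IH (leqnn _))) //.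
by rewrite -mulSn mulnC leq_mul2l ad ?orbT.
Qed.

Lemma digit_unique (a : nat -> nat) N n : (forall j, 1 <= j -> a j < d j) ->
  n = \sum_(1 <= j < N.+1) a j * q d j.-1 ->
  forall j, 1 <= j <= N -> a j = digit d j n.
Proof.
move=> ad; elim: N n => [|N IH] n nE j /andP[j1 jN].
  by move: j1; rewrite leqNgt ltnS jN.
rewrite big_nat_recr //= addnC in nE.
have lt_q := sum_lt_q N ad; set x := \sum_(_ <= _ < _) _ in nE lt_q.
move: jN; rewrite leq_eqVlt => /orP[/eqP->|jN].
  rewrite /digit /= nE divnMDl ?q_gt0 // divn_small // addn0 modn_small //.
  exact: ad.
rewrite (IH x erefl) ?j1 //.
have [k qk] : exists k, q d N = k * q d j.
  elim: N jN {IH nE lt_q x} => [|N IH]; first by case: j j1.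
  rewrite ltnS leq_eqVlt.
  case/orP=> [/eqP->|/IH[k qk]]; first by exists 1; rewrite mul1n.
  by exists (k * d N.+1); rewrite qS qk mulnAC.
rewrite /digit nE qk; case: j j1 {jN qk} => // j _ /=.
by rewrite qS (mulnC (q d j)) !mulnA divnMDl ?q_gt0 // modnMDl.
Qed.

Lemma zetaP n :
  [/\ 1 <= zeta d n, digit d (zeta d n) n <> d (zeta d n) - 1 &
      forall i, 1 <= i -> digit d i n <> d i - 1 -> zeta d n <= i].
Proof.
rewrite /zeta; case: xgetP => [j _ [[j1 dj] jmin]|].
  by split=> // i i1 di; exact: jmin.
pose P j := (1 <= j) && (digit d j n != d j - 1).
have exP : exists j, P j.
  exists n.+1; rewrite /P /= digit_eq0 ?ltn_q // eq_sym subn_eq0 -ltnNge.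
  exact: d_ge2.
case: (ex_minnP exP) => j /andP[j1 /eqP dj] jmin /(_ j)[]; split=> // i [i1 di].
by apply: jmin; rewrite /P i1; apply/eqP.
Qed.

End Facts.

(* The rows of s are finitely supported, so that the series always converges. *)
Lemma opSE (R : realType) (d : nat -> nat) (p : nat -> R) w n :
  opS d p w n = \sum_(0 <= k < n.+2) (s d p n k)%:C * w k.
Proof.
have lim_fin (K : numFieldType) (u : nat -> K) N :
    (forall m, (N <= m)%N -> u m = 0) ->
    limn (series u) = \sum_(0 <= k < N) u k.
  move=> uN; apply: cvg_lim => //; apply/cvgrPdist_lt => e e0.
  exists N => // m /= Nm; rewrite /series /= (big_cat_nat _ Nm) //= opprD addrA.
  rewrite subrr add0r normrN big_nat_cond big1 ?normr0 //.
  by move=> i /andP[/andP[Ni _] _]; exact: uN.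
apply: lim_fin => m nm; rewrite /s.
have /negPf -> : m != n.+1 by rewrite gtn_eqF.
have /negPf -> : m != n by rewrite gtn_eqF // ltnW.
rewrite big1 ?mul0r // => i /eqP nE.
by move: nm; rewrite nE !ltnNge (leq_trans (leq_addr _ _) (leqnSn _)).
Qed.

(* Main.v *)
Require Import Defs.
From mathcomp Require Import all_boot all_order all_algebra.
From mathcomp Require Import complex.
From mathcomp Require Import all_classical all_reals all_analysis.
From mathcomp Require Import ring lra zify.

Import Order.TTheory GRing.Theory Num.Theory numFieldNormedType.Exports.

Local Open Scope classical_set_scope.
Local Open Scope ring_scope.
Local Open Scope complex_scope.

(** For every complex [l], the sequence [w n = \prod_j (g_j l) ^+ (a_j n)]
    satisfies [S w = l w]: the digits of all the targets of row [n] are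
    explicit, and the equation telescopes thanks to the relation
    [p_(j+1) g_(j+1) = g_j ^ d_j - (1 - p_(j+1))]. This relation also shows
    that, once [p_j > 6/7], the bound [|g_j l| < 1/2] propagates to all later
    indices and forces [g_j l] to tend to 0. Then all but finitely many of the
    [g_j l] have modulus below 1, and a large [n] has a nonzero digit at a large
    index [j], where [|g_j l|] is small, so that [w] is in [c0]. Finally [g_j]
    is continuous and surjective. *)

(** * Limits, continuity and complex moduli *)

(** Once [e n] stays below [eps / 2 * (1 - a)], the recursion is dominated by an affine contraction
    of ratio [a] with fixed point [eps / 2]; the excess over that point decays like [a ^+ k]. *)
Lemma contraction_cvg0 {R : realType} (x e : nat -> R) (a : R) :
  0 <= a < 1 -> (forall n, 0 <= x n) -> e @ \oo --> (0 : R) ->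
  (forall n, x n.+1 <= a * x n + e n) -> x @ \oo --> (0 : R).
Proof.
move=> /andP[a0 a1] x0 /cvgr0Pnorm_lt e0 xS; apply/cvgr0Pnorm_lt => eps eps0.
have h0 : 0 < eps / 2 * (1 - a) by rewrite mulr_gt0 ?subr_gt0 // divr_gt0.
have [N _ eN] := e0 _ h0.
have xN k : x (N + k)%N <= eps / 2 + a ^+ k * x N.
  elim: k => [|k IH]; first by rewrite addn0 expr0 mul1r lerDr; lra.
  rewrite addnS; apply: le_trans (xS _) _.
  have := eN (N + k)%N (leq_addr _ _) => /(le_lt_trans (ler_norm _)) ek.
  have := ler_wpM2l a0 IH; rewrite exprS; nra.
have : (fun k => a ^+ k * x N) @ \oo --> (0 : R).
  rewrite -[X in _ --> X](mul0r (x N)); apply: cvgMl.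
  by apply: cvg_expr; rewrite ger0_norm.
move/cvgr0Pnorm_lt => /(_ (eps / 2)) []; first lra.
move=> M _ aM; exists (N + M)%N => // n /= nNM.
have nE : n = (N + (n - N))%N by lia.
rewrite ger0_norm // nE; apply: le_lt_trans (xN _) _.
have Mn : (M <= n - N)%N by lia.
have /(le_lt_trans (ler_norm _)) := aM _ Mn.
rewrite addrC; lra.
Qed.

Lemma affine_continuous (K : numFieldType) (a b : K) :
  continuous (fun z : K => (z - a) / b).
Proof.
have -> : (fun z => (z - a) / b) = *%R^~ b^-1 \o (+%R^~ (- a)) by [].
move=> x; apply: continuous_comp; last exact: mulrr_continuous.
exact: cvgD cvg_id (cvg_cst _).
Qed.

Lemma expr_continuous (K : numFieldType) n : continuous (fun z : K => z ^+ n).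
Proof.
move=> x; elim: n => [|n /(continuousM cvg_id) IH]; first exact: cst_continuous.
by rewrite /continuous_at exprS; under eq_fun do rewrite exprS; exact: IH.
Qed.

(** Moduli are elements of [R[i]]; this form moves inequalities between them to [R], where real
    arithmetic applies. *)
Lemma normcE (R : rcfType) (z : R[i]) : `|z| = (complex.Re `|z|)%:C.
Proof. by rewrite normc_def. Qed.

Lemma mul_g (R : realType) d (p : nat -> R) j z : p j.+1 != 0 ->
  (p j.+1)%:C * g d p j.+1 z = ftilde d p j z - (1 - p j.+1)%:C.
Proof. by move=> pj; rewrite /g /h /= mulrC divfK // fmorph_eq0. Qed.

(** * Digit expansions and products over digits *)

Section Eigenvector.
Context {R : realType} (d : nat -> nat) (p : nat -> R).
Hypotheses (d0 : d 0 = 1%N) (d_ge2 : forall j, (1 <= j)%N -> (2 <= d j)%N).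

(** The sum telescopes: its j-th term is [q d j - q d j.-1], and [q d 0 = 1]. *)
Lemma sum_max_digits r :
  (\sum_(1 <= j < r.+1) (d j - 1) * q d j.-1).+1%N = q d r.
Proof.
elim: r => [|r IH]; first by rewrite big_geq // q0.
rewrite big_nat_recr //= -addSn IH qS mulnC.
have := d_ge2 r.+1 isT; have := q_gt0 d0 d_ge2 r; nia.
Qed.

(** Stopping at [n] loses nothing: [n < q d n], so all digits of larger index vanish. *)
Definition digit_prod {K : pzRingType} (G : nat -> K) (n : nat) : K :=
  \prod_(1 <= j < n.+1) G j ^+ digit d j n.

Lemma digit_big j n : (n < j)%N -> digit d j n = 0%N.
Proof.
move=> nj; apply: digit_eq0; apply: leq_trans (ltn_q d0 d_ge2 j.-1).
by case: j nj.
Qed.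

Lemma digit_prod_widen {K : pzRingType} (G : nat -> K) {N n} :
  (n <= N)%N -> digit_prod G n = \prod_(1 <= j < N.+1) G j ^+ digit d j n.
Proof.
move=> nN; rewrite /digit_prod [RHS](big_cat_nat _ (n := n.+1)) //=.
rewrite [X in _ * X]big_nat_cond [X in _ * X]big1 ?mulr1 // => j.
by rewrite andbT => /andP[nj _]; rewrite digit_big.
Qed.

Lemma digit_prod_sum {K : pzRingType} (G : nat -> K) (a : nat -> nat) {N n} :
  (n <= N)%N -> (forall j, (1 <= j)%N -> (a j < d j)%N) ->
  n = \sum_(1 <= j < N.+1) a j * q d j.-1 ->
  digit_prod G n = \prod_(1 <= j < N.+1) G j ^+ a j.
Proof.
move=> nN ad nE; rewrite (digit_prod_widen _ nN); apply: eq_big_nat => j jN.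
by rewrite (digit_unique d0 d_ge2 ad nE jN).
Qed.

Lemma zeta_le n : (zeta d n <= n.+1)%N.
Proof.
have [_ _ +] := zetaP d0 d_ge2 n; apply=> //.
rewrite digit_big //; have := d_ge2 n.+1 isT; lia.
Qed.

Lemma digit_lt_zeta n j : (1 <= j < zeta d n)%N -> digit d j n = (d j - 1)%N.
Proof.
move=> /andP[j1 jz]; have [_ _ zmin] := zetaP d0 d_ge2 n.
apply/eqP/negPn/negP => /eqP /(zmin _ j1); lia.
Qed.

Lemma sum_digits n : n = \sum_(1 <= j < n.+2) digit d j n * q d j.-1.
Proof.
by apply: digit_expansion => //; apply: ltnW; apply: ltn_q.
Qed.

(** Otherwise [n] would be the sum of its first [N] digit terms, which is less than [q d N]. *)
Lemma exists_large_digit N n : (q d N <= n)%N ->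
  exists j, [/\ (N < j)%N, (j <= n)%N & (0 < digit d j n)%N].
Proof.
move=> qn; apply: contrapT => nex.
have dig0 j : (N < j)%N -> digit d j n = 0%N.
  move=> Nj; have [nj|jn] := ltnP n j; first by rewrite digit_big.
  apply/eqP; rewrite -leqn0 leqNgt; apply/negP => dj.
  by apply: nex; exists j.
have nE : (n = \sum_(1 <= j < (n + N).+1) digit d j n * q d j.-1)%N.
  apply: digit_expansion => //.
  by apply: leq_trans (ltn_q d0 d_ge2 (n + N)); rewrite ltnS leq_addr.
have := sum_lt_q d0 (a := digit d ^~ n) N (fun j => @digit_lt d d_ge2 j n).
move: nE; rewrite (big_cat_nat _ (n := N.+1)) //=; last lia.
rewrite [X in (_ + X)%N]big_nat_cond [X in (_ + X)%N]big1 ?addn0; last first.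
  by move=> j; rewrite andbT => /andP[Nj _]; rewrite dig0.
by move=> <-; rewrite ltnNge qn.
Qed.

(** The factors up to [J] are bounded together by a constant [C]. Beyond [J] all factors have
    modulus at most 1, and for large [n] one of them is below [e / C]. *)
Lemma digit_prod_cvg0 (K : numFieldType) (G : nat -> K) :
  G @ \oo --> (0 : K) -> digit_prod G @ \oo --> (0 : K).
Proof.
move=> /cvgr0Pnorm_lt G0; apply/cvgr0Pnorm_lt => e e0.
have [J _ GJ] := G0 _ ltr01.
(* Adding 1 makes each base at least 1, so that the digit in the exponent can be raised to [d j]. *)
pose C := \prod_(1 <= j < J.+1) (1 + `|G j|) ^+ d j.
have C0 : 0 < C by apply: prodr_gt0 => j _; rewrite exprn_gt0 // ltr_pwDl.
have [M _ GM] := G0 _ (divr_gt0 e0 C0).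
exists (q d (maxn J M)) => //= n /exists_large_digit [j [Nj jn dj]].
have [Jj Mj] : (J < j)%N /\ (M < j)%N by lia.
rewrite normr_prod (big_cat_nat _ (n := J.+1)) //=; last lia.
have le1 a b : (J < a)%N -> \prod_(a <= i < b) `|G i ^+ digit d i n| <= 1.
  move=> Ja; rewrite big_nat_cond; apply: prodr_ile1 => i.
  rewrite andbT => /andP[ai _].
  rewrite normr_ge0 normrX exprn_ile1 //; apply/ltW/GJ => /=; lia.
have lt : \prod_(J.+1 <= i < n.+1) `|G i ^+ digit d i n| < e / C.
  rewrite (big_cat_nat _ (n := j)) //= ?(big_ltn (m := j)) //; try lia.
  rewrite mulrCA; apply: (@le_lt_trans _ _ `|G j ^+ digit d j n|).
    rewrite -[leRHS]mulr1; apply: ler_wpM2l => //.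
    by rewrite -[leRHS]mulr1; apply: ler_pM; rewrite ?prodr_ge0 // ?le1 // ltnW.
  rewrite normrX; apply: (le_lt_trans (y := `|G j|)); last first.
    by apply: GM; exact: ltnW.
  rewrite -(prednK dj) exprS -[leRHS]mulr1; apply: ler_wpM2l => //.
  by apply: exprn_ile1 => //; apply/ltW/GJ; exact: ltnW.
rewrite -[ltRHS](divfK (lt0r_neq0 C0)) [ltRHS]mulrC.
move: lt; rewrite -(ltr_pM2l C0); apply: le_lt_trans.
apply: ler_wpM2r; first by apply: prodr_ge0.
rewrite /C big_nat_cond [leRHS]big_nat_cond; apply: ler_prod => i.
rewrite andbT => /andP[i1 _]; rewrite normr_ge0 normrX /=.
apply: (@le_trans _ _ ((1 + `|G i|) ^+ digit d i n)).
  by apply: lerXn2r; rewrite ?nnegrE ?addr_ge0 // lerDr.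
by apply: ler_weXn2l; [rewrite lerDl | exact/ltnW/digit_lt].
Qed.

(** * Digit products at the targets of a row *)

Section Ring.
Context {K : comPzRingType} (G : nat -> K).
Local Notation w := (digit_prod G).

(** The factor of the digits above [zeta d n], which no transition from [n] changes. The range goes
    up to index [n.+1], the largest possible value of [zeta d n]. *)
Definition tail_prod n := \prod_((zeta d n).+1 <= j < n.+2) G j ^+ digit d j n.

(** The digits 1 to [r] are maximal, so the subtraction resets them to 0 and leaves the others
    alone. The case [r = 0] factors [w n] itself. *)
Lemma digit_prod_split n r : (r < zeta d n)%N ->
  w (n - \sum_(1 <= j < r.+1) (d j - 1) * q d j.-1) =
  (\prod_(r.+1 <= j < zeta d n) G j ^+ (d j - 1)) *
  G (zeta d n) ^+ digit d (zeta d n) n * tail_prod n.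
Proof.
move=> rz; have zn := zeta_le n; have [z1 _ _] := zetaP d0 d_ge2 n.
set T := (\sum_(1 <= j < _) _)%N.
pose b j := if (j <= r)%N then 0%N else digit d j n.
have nE : (n - T = \sum_(1 <= j < n.+2) b j * q d j.-1)%N.
  rewrite {1}(sum_digits n).
  rewrite !(big_cat_nat _ (m := 1) (n := r.+1) (p := n.+2)) //=; try lia.
  rewrite [X in (_ = X + _)%N]big_nat_cond [X in (_ = X + _)%N]big1 ?add0n;
    last first.
    by move=> j; rewrite andbT /b ltnS => /andP[_ ->].
  rewrite (_ : \sum_(1 <= j < r.+1) _ = T)%N; last first.
    by apply: eq_big_nat => j jr; rewrite digit_lt_zeta; lia.
  rewrite addKn; apply: eq_big_nat => j /andP[rj _].
  by rewrite /b leqNgt rj.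
rewrite (digit_prod_sum _ b _ _ nE); first last.
- move=> j j1; rewrite /b; case: ifP => _; last exact: digit_lt.
  by have := d_ge2 j j1; lia.
- lia.
rewrite (big_cat_nat _ (n := r.+1)) //=; last lia.
rewrite big_nat_cond big1 ?mul1r; last first.
  by move=> j; rewrite andbT /b ltnS => /andP[_ ->].
rewrite (big_cat_nat _ (n := zeta d n)) //=; last lia.
rewrite (big_ltn (m := zeta d n)) //= mulrA.
have -> : b (zeta d n) = digit d (zeta d n) n by rewrite /b leqNgt rz.
rewrite /tail_prod; congr (_ * _ * _); apply: eq_big_nat => j /andP[j1 j2].
  by rewrite /b leqNgt j1 /= digit_lt_zeta // j2 andbT; lia.
by rewrite /b leqNgt (leq_trans rz (ltnW j1)).
Qed.

(** Adding one carries through the maximal digits below [zeta d n], which become 0, and increments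
    the digit at [zeta d n]. *)
Lemma digit_prodS n :
  w n.+1 = G (zeta d n) ^+ (digit d (zeta d n) n).+1 * tail_prod n.
Proof.
have zn := zeta_le n; have [z1 dz _] := zetaP d0 d_ge2 n.
have dlt := digit_lt d_ge2 (j := zeta d n) n z1.
pose b j := if (j < zeta d n)%N then 0%N else
  if j == zeta d n then (digit d j n).+1 else digit d j n.
have bz : b (zeta d n) = (digit d (zeta d n) n).+1 by rewrite /b ltnn eqxx.
have nE : (n.+1 = \sum_(1 <= j < n.+2) b j * q d j.-1)%N.
  rewrite {1}(sum_digits n).
  rewrite !(big_cat_nat _ (m := 1) (n := zeta d n) (p := n.+2)) //=; try lia.
  rewrite !(big_ltn (m := zeta d n)) //.
  rewrite [in RHS]big_nat_cond [in RHS]big1 ?add0n; last first.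
    by move=> j; rewrite andbT /b => /andP[_ ->].
  rewrite bz mulSn -addSn -addnA; congr (_ + (_ + _))%N.
    (* The maximal digits plus the added one make up exactly one unit of the position [zeta d n]. *)
    rewrite -sum_max_digits prednK //; congr _.+1.
    by apply: eq_big_nat => j jr; rewrite digit_lt_zeta.
  by apply: eq_big_nat => j /andP[jz _]; rewrite /b ltnNge (ltnW jz) /= gtn_eqF.
rewrite (digit_prod_sum _ b _ _ nE) //; last first.
  move=> j j1; rewrite /b; have := d_ge2 j j1; have := digit_lt d_ge2 n j1.
  have [_|_] := ltnP j (zeta d n); first lia.
  by case: eqP => [->|_]; lia.
rewrite (big_cat_nat _ (n := zeta d n)) //=; last lia.
rewrite big_nat_cond big1 ?mul1r; last first.
  by move=> j; rewrite andbT /b => /andP[_ ->].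
rewrite (big_ltn (m := zeta d n)) //= bz; congr (_ * _).
by apply: eq_big_nat => j /andP[jz _]; rewrite /b ltnNge (ltnW jz) /= gtn_eqF.
Qed.

End Ring.

(** * The eigenvalue equation *)

Section Operator.
Hypothesis p_itv : forall j, (1 <= j)%N -> 0 < p j <= 1.

(** The diagonal entry becomes the term [r = 0], with empty product and empty sum, so that all
    non-increasing moves share one formula. *)
Lemma opS_sum (v : nat -> R[i]) n : opS d p v n =
  (\prod_(1 <= j < (zeta d n).+1) p j)%:C * v n.+1 +
  \sum_(0 <= r < zeta d n) ((1 - p r.+1) * \prod_(1 <= j < r.+1) p j)%:C *
    v (n - \sum_(1 <= j < r.+1) (d j - 1) * q d j.-1)%N.
Proof.
have [z1 _ _] := zetaP d0 d_ge2 n.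
have T_gt0 r : (0 < r)%N -> (0 < \sum_(1 <= j < r.+1) (d j - 1) * q d j.-1)%N.
  have := sum_max_digits r; have := ltn_q d0 d_ge2 r; lia.
have T_le r : (r < zeta d n)%N ->
    (\sum_(1 <= j < r.+1) (d j - 1) * q d j.-1 <= n)%N.
  move=> rz; have zn := zeta_le n.
  rewrite [leqRHS](sum_digits n).
  rewrite (big_cat_nat _ (m := 1) (n := r.+1) (p := n.+2)) //=; last lia.
  apply: leq_trans (leq_addr _ _); rewrite leq_eqVlt; apply/orP; left.
  apply/eqP.
  by apply: eq_big_nat => j jr; rewrite digit_lt_zeta; lia.
rewrite opSE big_nat_recr //= big_nat_recr //= {3}/s eqxx addrC; congr (_ + _).
rewrite (@big_ltn _ _ _ 0 (zeta d n)) // !(@big_geq _ _ _ 1 1) //.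
rewrite mulr1 subn0 addrC.
congr (_ + _); first by rewrite /s ltn_eqF // eqxx.
under eq_big_nat => k /andP[_ kn].
  rewrite /s !ltn_eqF //; last exact: ltnW.
  rewrite rmorph_sum mulr_suml big_mkcond /=.
  over.
rewrite exchange_big_nat /=; apply: eq_big_nat => r /andP[r1 rz].
set T := (\sum_(1 <= j < r.+1) (d j - 1) * q d j.-1)%N.
have := T_gt0 r r1; have := T_le r rz; rewrite -/T => Tn T0.
(* [T0] puts the column [n - T] strictly below the diagonal, and [Tn] makes the subtraction
   exact. *)
rewrite (bigD1_seq (n - T)%N) ?mem_index_iota ?iota_uniq //=; last lia.
rewrite subnK // eqxx [X in _ + X]big1 ?addr0 // => k kn.
by case: eqP => // nE; move: kn; rewrite nE addnK eqxx.
Qed.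

Lemma digit_prod_eigen (l : R[i]) n :
  opS d p (digit_prod (fun j => g d p j l)) n =
  l * digit_prod (fun j => g d p j l) n.
Proof.
set G := fun j => _.
have [z1 _ _] := zetaP d0 d_ge2 n.
have GE j : (p j.+1)%:C * G j.+1 = ftilde d p j l - (1 - p j.+1)%:C.
  by apply: mul_g; have := p_itv j.+1 isT; lra.
(* This is the row equation with [k] for [zeta d n], after cancelling the factor common to all
   targets. In the induction step the two new terms combine, by [GE], into the previous leading term
   times [G k.+1 ^+ (d k.+1 - 1)]. *)
have key k : (1 <= k)%N ->
  (\prod_(1 <= j < k.+1) p j)%:C * G k +
  \sum_(0 <= r < k) ((1 - p r.+1) * \prod_(1 <= j < r.+1) p j)%:C *
    (\prod_(r.+1 <= j < k) G j ^+ (d j - 1)) =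
  l * \prod_(1 <= j < k) G j ^+ (d j - 1).
  elim: k => // -[_ _|k IH _].
    rewrite !big_nat1 !big_geq // !mulr1 GE /=; ring.
  have Gd : ftilde d p k.+1 l = G k.+1 ^+ (d k.+1 - 1) * G k.+1.
    by rewrite -exprSr -subSn ?subn1 //; have := d_ge2 k.+1 isT; lia.
  rewrite [in RHS]big_nat_recr //= mulrA -IH //.
  rewrite (@big_nat_recr _ _ _ k.+2 1) //= (@big_nat_recr _ _ _ k.+1 0) //=.
  rewrite (@big_geq _ _ _ k.+2 k.+2) // mulr1.
  under [X in _ + (X + _)]eq_big_nat => r /andP[_ rk]
    do rewrite (@big_nat_recr _ _ _ k.+1 r.+1) //= mulrA.
  rewrite -mulr_suml !rmorphM /= -!mulrA GE Gd; ring.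
rewrite opS_sum digit_prodS.
have w0 := digit_prod_split G n 0 z1.
rewrite big_geq // subn0 in w0; rewrite w0.
under [X in _ + X = _]eq_big_nat => r /andP[_ rz]
  do rewrite digit_prod_split // !mulrA.
rewrite -!mulr_suml exprS.
set D := G (zeta d n) ^+ digit _ _ _; set t := tail_prod _ _.
have := key _ z1; set S1 := \sum_(_ <= _ < _) _; set P := (_)%:C => kE.
have -> : P * (G (zeta d n) * D * t) + S1 * D * t =
    (P * G (zeta d n) + S1) * (D * t) by ring.
by rewrite kE; ring.
Qed.

End Operator.

End Eigenvector.

(** * Dynamics of the maps [g d p j] *)

Section Iteration.
Context {R : realType} {d : nat -> nat} {p : nat -> R}.
Hypotheses (d_ge2 : forall j, (1 <= j)%N -> (2 <= d j)%N)
  (p_itv : forall j, (1 <= j)%N -> 0 < p j <= 1).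

Lemma h_continuous j : continuous (h p j : R[i] -> R[i]).
Proof. exact: (@affine_continuous R[i]). Qed.

Lemma ftilde_continuous j : continuous (ftilde d p j : R[i] -> R[i]).
Proof.
elim: j => [|j IH] /=; first by move=> x; exact: cvg_id.
move=> x.
apply: (@continuous_comp _ _ _ (h p j.+1 \o ftilde d p j)
  (fun z : R[i] => z ^+ d j.+1)).
  exact: (@continuous_comp _ _ _ (ftilde d p j) (h p j.+1) x (IH x)
    (h_continuous _ _)).
exact: (@expr_continuous R[i]).
Qed.

Lemma g_continuous j : continuous (g d p j : R[i] -> R[i]).
Proof.
move=> x.
exact: (@continuous_comp _ _ _ (ftilde d p j.-1) (h p j) x
  (ftilde_continuous _ _) (h_continuous _ _)).
Qed.

Lemma norm_g_step j z : (1 <= j)%N ->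
  p j.+1 * complex.Re `|g d p j.+1 z| <=
  complex.Re `|g d p j z| ^+ d j + (1 - p j.+1).
Proof.
move=> j1; have pj := p_itv j.+1 isT.
have := ler_normB (ftilde d p j z) (1 - p j.+1)%:C.
rewrite -mul_g; last lra.
rewrite normrM.
have nC (x : R) : 0 <= x -> `|x%:C| = x%:C.
  by move=> x0; rewrite ger0_norm // lecR.
rewrite !nC; [|lra|lra].
have -> : ftilde d p j z = g d p j z ^+ d j by case: j j1 {pj}.
rewrite normrX => le_norm; rewrite -lecR.
by rewrite rmorphM rmorphD rmorphXn /= -!normcE.
Qed.

Lemma g_cvg0 J z : p @ \oo --> (1 : R) -> (1 <= J)%N ->
  (forall j, (J <= j)%N -> 6 / 7 < p j) ->
  `|g d p J z| < (1 / 2)%:C -> g d p ^~ z @ \oo --> (0 : R[i]).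
Proof.
move=> p1 J1 pJ; rewrite normcE ltcR => gJ.
pose x k := complex.Re `|g d p (J + k) z|.
have x0 k : 0 <= x k by rewrite -lecR -normcE; exact: normr_ge0.
have xS k : p (J + k).+1 * x k.+1 <= x k ^+ d (J + k) + (1 - p (J + k).+1).
  by rewrite /x addnS; apply: norm_g_step; rewrite (leq_trans J1) // leq_addr.
have pS k : 6 / 7 < p (J + k).+1 <= 1.
  have := p_itv (J + k).+1 isT; have := pJ (J + k).+1.
  have : (J <= (J + k).+1)%N by lia.
  by move=> Jk /(_ Jk); lra.
have xd k : x k <= 1 / 2 -> x k ^+ d (J + k) <= x k / 2.
  move=> xk; apply: (@le_trans _ _ (x k ^+ 2)).
    by apply: ler_wiXn2l; [exact: x0 | lra | apply: d_ge2; lia].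
  by have := x0 k; rewrite expr2; nra.
have x_half k : x k <= 1 / 2.
  (* With [6 / 7 < p], the next modulus is at most [7 / 6 * (1 / 4 + 1 / 7) = 11 / 24]. *)
  elim: k => [|k IH]; first by rewrite /x addn0 ltW.
  by have := xS k; have := xd k IH; have := pS k; have := x0 k.+1; nra.
have xcvg : x @ \oo --> (0 : R).
  (* Dividing [xS] by [p > 6 / 7] costs a factor [7 / 6]; with [xd] the ratio is
     [7 / 6 * (1 / 2) = 7 / 12]. *)
  apply: (@contraction_cvg0 _ x (fun k => 7 / 6 * (1 - p (J + k).+1))
    (7 / 12)) => //.
  - lra.
  - rewrite -[X in _ --> X](mulr0 (7 / 6)); apply: cvgMr.
    rewrite -(subrr 1); apply: cvgB; first exact: cvg_cst.
    move: p1; rewrite -(cvg_shiftn J.+1).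
    by under eq_fun do rewrite addnS addnC.
  - move=> k; have := xS k; have := xd k (x_half k); have := pS k.
    by have := x0 k.+1; nra.
apply/cvgr0Pnorm_lt => e e0.
(* A positive element of [R[i]] has zero imaginary part. *)
have eE : e = (complex.Re e)%:C.
  by case: e e0 => a b; rewrite ltcE /= => /andP[/eqP -> _].
have /cvgr0Pnorm_lt /(_ (complex.Re e)) [|N _ xN] := xcvg.
  by rewrite -ltcR -eE.
exists (J + N)%N => // j /= jJN.
have Nj : (N <= j - J)%N by lia.
rewrite eE normcE ltcR -(subnKC (leq_trans (leq_addr N J) jJN)).
exact: le_lt_trans (ler_norm _) (xN _ Nj).
Qed.

(** Each [h p i] is an invertible affine map, and every complex number has a [d i]-th root. *)
Lemma g_surj j (y : R[i]) : (1 <= j)%N -> exists z, g d p j z = y.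
Proof.
move=> j1.
have hs i (u : R[i]) : (1 <= i)%N -> exists z, h p i z = u.
  move=> i1; exists (u * (p i)%:C + (1 - p i)%:C).
  rewrite /h addrK mulfK //; have := p_itv i i1; rewrite fmorph_eq0; lra.
have fs i (u : R[i]) : exists z, ftilde d p i z = u.
  elim: i u => [|i IH] u; first by exists u.
  have [v vE] := hs i.+1 ((d i.+1).-root u) isT.
  have [z zE] := IH v; exists z; rewrite /= /f zE vE rootCK //.
  exact: ltnW (d_ge2 i.+1 isT).
have [v vE] := hs j y j1; have [z zE] := fs j.-1 v.
by exists z; rewrite /g zE.
Qed.

End Iteration.

(** * Open sets of eigenvalues *)

Theorem proposition4p7 (R : realType) (d : nat -> nat) (p : nat -> R)
    (d0 : d 0%N = 1%N) (d_ge2 : forall j : nat, (1 <= j)%N -> (2 <= d j)%N)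
    (p_itv : forall j : nat, (1 <= j)%N -> 0 < p j <= 1)
    (p_lim : p @ \oo --> (1 : R)) :
  (sigma_p d p)° !=set0 /\
  exists (r : R) (j0 : nat), 0 < r /\ (1 <= j0)%N /\
    forall j : nat, (j0 <= j)%N ->
      open (g d p j @^-1` ball (0 : R[i]) r%:C) /\
      g d p j @^-1` ball (0 : R[i]) r%:C `<=` sigma_p d p.
Proof.
have [J [J1 pJ]] : exists J, (1 <= J)%N /\ forall j, (J <= j)%N -> 6 / 7 < p j.
  have [|N _ pN] := (cvgrPdist_lt _ _).1 p_lim (1 / 7); first lra.
  exists N.+1; split=> // j /ltnW/pN /=; rewrite ltr_distlC; lra.
have inE j z : (g d p j @^-1` ball (0 : R[i]) (1 / 2)%:C) z <->
    `|g d p j z| < (1 / 2)%:C by rewrite /= -ball_normE /= sub0r normrN.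
have gopen j : open (g d p j @^-1` ball (0 : R[i]) (1 / 2)%:C).
  apply: open_comp; first by move=> z _; exact: g_continuous.
  exact: (@ball_open _ (R[i] : normedModType R[i])).
have gsub j : (J <= j)%N ->
    g d p j @^-1` ball (0 : R[i]) (1 / 2)%:C `<=` sigma_p d p.
  move=> Jj l /inE gl.
  have g0 := g_cvg0 d_ge2 p_itv j l p_lim (leq_trans J1 Jj)
    (fun i ji => pJ i (leq_trans Jj ji)) gl.
  exists (digit_prod d (g d p ^~ l)); split.
  - exact: digit_prod_cvg0.
  (* The eigenvector takes the value 1, an empty product, at 0. *)
  - move=> /(congr1 (fun w => w 0%N)); rewrite /digit_prod big_geq //=.
    by move/eqP; rewrite oner_eq0.
  - by move=> n; apply: digit_prod_eigen.
split; last first.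
  exists (1 / 2), J; split; first lra.
  by split=> // j Jj; split; [exact: gopen | exact: gsub].
(* A zero of [g d p J] lies in the open preimage, hence in the interior. *)
have [z z0] := g_surj d_ge2 p_itv J 0 J1.
exists z; apply: (interiorS (gsub J (leqnn _))); rewrite (interior_id _).1 //.
by apply/inE; rewrite z0 normr0 ltcR; lra.
Qed.
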